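(* Let $a(x)\in\mathbf{U}$ be such that $1\prec a(x)\prec x$, i.e. $\lim_{x\to\infty}|a(x)|=\infty$ and $\lim_{x\to\infty}a(x)/x=0$. Let $W(x)\in\mathbf{E}$ be such that $w(x):=W'(x)$ is positive and non-increasing and $\lim_{x\to\infty}W(x)=\infty$. Suppose that there exists $c>0$ such that $$W(x)\ge \exp\left(|a(x)|^{c}\right)$$ for all sufficiently large $x$. Then $(\lfloor a(n)\rfloor)_{n\in\mathbb{N}}$ is pointwise $L^\infty$-bad for $W$-averages.
   Context: Let $\mathbf{B}$ be the ring of germs at $+\infty$ of continuous real functions on $\mathbb{R}$. A Hardy field is a subfield of $\mathbf{B}$ closed under differentiation. $\mathbf{U}$ denotes the union of all Hardy fields. A Hardy field is maximal if it is not a proper subfield of a larger Hardy field; $\mathbf{E}$ denotes the intersection of all maximal Hardy fields. Since these are germs, properties such as positivity and monotonicity are understood for all sufficiently large $x$, and finitely many values of $n$ are irrelevant in the limits below. The sequence $(\lfloor a(n)\rfloor)_{n\in\mathbb{N}}$ is pointwise $L^p$-bad for $W$-averages if for every aperiodic probability measure preserving system $(X,\mathcal{B},\mu,T)$ there exists $f\in L^p(\mu)$ such that, for $\mu$-almost every $x\in X$, the averages $$\frac{1}{W(N)}\sum_{n=1}^N w(n)\,f(T^{\lfloor a(n)\rfloor}x)$$ fail to converge as $N\to\infty$. Here $(X,\mathcal{B},\mu)$ is a standard Lebesgue space (measure-theoretically isomorphic to $[0,1]$ with Lebesgue measure), aperiodic means that the set of periodic points of $T$ has measure zero, and $T$ is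 taken invertible when $a$ is eventually negative, so that the averages are defined. *)

(* Defs.v *)
From mathcomp Require Import all_boot all_order all_algebra.
From mathcomp Require Import all_classical all_reals all_analysis.
From mathcomp Require Import measurable_realfun.

Set Implicit Arguments.
Unset Strict Implicit.
Unset Printing Implicit Defensive.

Import Order.TTheory GRing.Theory Num.Theory.
Import numFieldNormedType.Exports.

Local Open Scope classical_set_scope.
Local Open Scope ring_scope.

Section HardyFields.
Context {R : realType}.
Implicit Types (f g : R -> R) (H : set (R -> R)).

Definition germ_eq f g : Prop := \forall x \near +oo, f x = g x.

(* A set of germs is represented by the set of all functions whose germ belongs
   to it, i.e. by a set of functions saturated for [germ_eq]; inclusion and
   equality of sets of germs are then inclusion and equality of the saturated
   sets.  Only the values of a function near +oo matter: a representative need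
   not be continuous on the whole line, but its germ must be the germ of a
   continuous function. *)
Record hardy_field H : Prop := HardyField {
  hardy_saturated : forall f g, H f -> germ_eq f g -> H g;
  hardy_continuous : forall f, H f -> exists2 g, continuous g & germ_eq f g;
  hardy_one : H (fun=> 1);
  hardy_sub : forall f g, H f -> H g -> H (fun x => f x - g x);
  hardy_mul : forall f g, H f -> H g -> H (fun x => f x * g x);
  hardy_inv : forall f, H f -> ~ germ_eq f (fun=> 0) ->
    exists2 g, H g & germ_eq (fun x => f x * g x) (fun=> 1);
  hardy_derive : forall f, H f ->
    (\forall x \near +oo, derivable f x 1) /\ H (derive1 f)
}.

Definition maximal_hardy_field H : Prop :=
  hardy_field H /\ forall H', hardy_field H' -> H `<=` H' -> H' = H.

Definition hardy_U : set (R -> R) := \bigcup_(H in hardy_field) H.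

Definition hardy_E : set (R -> R) := \bigcap_(H in maximal_hardy_field) H.

End HardyFields.

Section Systems.
Context {R : realType} {d : measure_display} {X : measurableType d}.
Variable mu : probability X R.
Implicit Types T S : X -> X.

(* [mu] is isomorphic mod 0 to Lebesgue measure on [0, 1].  Null sets are
   disregarded: for [psi], measurability refers to the Lebesgue (completed
   Borel) sets, so that the sigma-algebra of [X] may be complete or not.  That
   [psi] carries Lebesgue measure to [mu] follows from the other clauses. *)
Definition lebesgue_space : Prop :=
  exists (phi : X -> R) (psi : R -> X),
    [/\ measurable_fun [set: X] phi,
        forall B : set R, measurable B ->
          mu (phi @^-1` B) = lebesgue_measure (B `&` `[0, 1]),
        forall A : set X, measurable A ->
          completed_algebra_gen (@lebesgue_measure R) (`[0, 1] `&` psi @^-1` A),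
        {ae mu, forall x, psi (phi x) = x} &
        {ae @lebesgue_measure R, forall t, t \in `[0, 1] -> phi (psi t) = t}].

Definition measure_preserving T : Prop :=
  measurable_fun [set: X] T /\
  forall A : set X, measurable A -> mu (T @^-1` A) = mu A.

Definition aperiodic T : Prop :=
  mu.-negligible [set x | exists2 n, (0 < n)%N & iter n T x = x].

Definition ae_inverse T S : Prop :=
  [/\ measurable_fun [set: X] S,
      {ae mu, forall x, S (T x) = x} & {ae mu, forall x, T (S x) = x}].

End Systems.

(* T^k, where S plays the role of T^{-1}. *)
Definition int_iter (X : Type) (T S : X -> X) (k : int) : X -> X :=
  match k with
  | Posz n => iter n T
  | Negz n => iter n.+1 S
  end.

Definition weighted_average (R : realType) (X : Type) (a W : R -> R)
    (T S : X -> X) (f : X -> R) (x : X) (N : nat) : R :=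
  (W N%:R)^-1 *
  \sum_(1 <= n < N.+1) derive1 W n%:R * f (int_iter T S (Num.floor (a n%:R)) x).

(* T is required to be invertible, with inverse S, only when a is eventually
   negative.  If a is eventually nonnegative then S is arbitrary: it is used for
   finitely many n only, and so does not affect convergence when W tends to
   infinity. *)
Definition pointwise_bad (R : realType) (p : \bar R) (a W : R -> R) : Prop :=
  forall (d : measure_display) (X : measurableType d) (mu : probability X R)
    (T S : X -> X),
  lebesgue_space mu -> measure_preserving mu T -> aperiodic mu T ->
  ((\forall x \near +oo, a x < 0) -> ae_inverse mu T S) ->
  exists2 f : X -> R, f \in Lfun mu p &
    {ae mu, forall x, ~ cvgn (weighted_average a W T S f x)}.

(* Main.v *)
Require Import Defs.
From mathcomp Require Import all_boot all_order all_algebra.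
From mathcomp Require Import all_classical all_reals all_analysis.
From mathcomp Require Import measurable_realfun ess_sup_inf.
From mathcomp Require Import ring lra zify.

Set Implicit Arguments.
Unset Strict Implicit.
Unset Printing Implicit Defensive.

Import Order.TTheory GRing.Theory Num.Theory.
Import numFieldNormedType.Exports.

Local Open Scope classical_set_scope.
Local Open Scope ring_scope.

(** Both [a] and [W] lie in a common Hardy field, in which [W / |a| ^ C] is, for
    every natural number [C], eventually monotone; as [W >= exp (|a| ^ c)], it
    tends to infinity, hence it is eventually nondecreasing.  Therefore, for every
    [eta > 0], almost all the weight of the average stopped when [|a|] reaches [m]
    sits on the [n] with [(1 - eta) * m < |a n| <= m]: these averages behave like
    averages over the windows [m - l, m] of the orbit, with [l] negligible with
    respect to [m].

    A Rokhlin-type lemma gives a set [A] of measure at most [1 / h] which most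
    orbits visit at some time [m] between [h] and [3 h].  The union [F] of the
    first [l] preimages of [A] has measure at most [l / h], but contains the whole
    window ending at [m].  A function that equals 0 or 1 on such an [F] thus has,
    at most points, an average close to 0 or 1, although [F] is arbitrarily small.
    Prescribing alternately the values 0 and 1 on sets [F] of fast decreasing
    measure makes the averages oscillate almost everywhere, by the Borel-Cantelli
    lemma. *)

(** * Hardy fields: maximal extensions, signs and monotonicity *)

Section HardyField.
Context {R : realType}.
Implicit Types (f g : R -> R) (H : set (R -> R)).

Lemma near_pinftyP (P : R -> Prop) :
  (\forall x \near +oo, P x) <-> exists M, forall x, M <= x -> P x.
Proof.
split=> [[M [_ MP]]|[M MP]].
  by exists (M + 1) => x Mx; apply: MP; rewrite (lt_le_trans _ Mx)// ltrDl.
by near=> x; apply: MP.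
Unshelve. all: by end_near. Qed.

(** Each closure property involves at most two elements, hence can be checked inside a subfield
    containing both. This handles unions of chains in Zorn's lemma. *)
Lemma hardy_field_directed H :
  H (fun=> 1) ->
  (forall f g, H f -> H g ->
    exists K, [/\ hardy_field K, K `<=` H, K f & K g]) ->
  hardy_field H.
Proof.
move=> H1 HK; split=> //.
- move=> f g Hf fg; have [K [hK KH Kf _]] := HK _ _ Hf Hf.
  exact/KH/(hardy_saturated hK Kf fg).
- move=> f Hf; have [K [hK KH Kf _]] := HK _ _ Hf Hf.
  exact: hardy_continuous hK _ Kf.
- move=> f g Hf Hg; have [K [hK KH Kf Kg]] := HK _ _ Hf Hg.
  by apply: KH; exact: hardy_sub.
- move=> f g Hf Hg; have [K [hK KH Kf Kg]] := HK _ _ Hf Hg.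
  by apply: KH; exact: hardy_mul.
- move=> f Hf f0; have [K [hK KH Kf _]] := HK _ _ Hf Hf.
  by have [g Kg fg] := hardy_inv hK Kf f0; exists g => //; exact: KH.
- move=> f Hf; have [K [hK KH Kf _]] := HK _ _ Hf Hf.
  by have [? ?] := hardy_derive hK Kf; split=> //; exact: KH.
Qed.

Lemma hardy_field_maximal H : hardy_field H ->
  exists2 H', maximal_hardy_field H' & H `<=` H'.
Proof.
(* Zorn's lemma is applied to the sets [A] with [H `|` A] a Hardy field, so that
   the empty chain has a bound. *)
move=> hH; pose P (A : set (R -> R)) := hardy_field (H `|` A).
have [F FP Ftot|A [PA Amax]] := @Zorn_bigcup (R -> R) P.
  apply: hardy_field_directed; first by left; exact: hardy_one hH.
  have sub A : F A -> H `|` A `<=` H `|` \bigcup_(X in F) X.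
    by move=> FA f [Hf|Af]; [left|right; exists A].
  move=> f g [Hf|[A FA Af]] [Hg|[B FB Bg]].
  - by exists H; split=> // h; left.
  - by exists (H `|` B); split; [exact: FP|exact: sub|left|right].
  - by exists (H `|` A); split; [exact: FP|exact: sub|right|left].
  - have [AB|BA] := Ftot _ _ FA FB.
    + by exists (H `|` B); split; [exact: FP|exact: sub|right; exact: AB|right].
    + by exists (H `|` A); split; [exact: FP|exact: sub|right|right; exact: BA].
exists (H `|` A); last by move=> f; left.
split=> // H' hH' AH'; apply/seteqP; split=> // f H'f.
apply: contrapT => nf; apply: (Amax H').
  split=> [h Ah|H'A]; first by apply: AH'; right.
  by apply: nf; right; exact: H'A.
suff -> : P H' = hardy_field H' by [].
by rewrite /P setUidr// => h Hh; apply: AH'; left.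
Qed.

(** A Hardy field containing [f] extends to a maximal one, and [g] lies in every maximal one. This
    lets [a] and [W] be compared within a single field. *)
Lemma hardy_U_E f g : hardy_U f -> hardy_E g ->
  exists H, [/\ hardy_field H, H f & H g].
Proof.
move=> [H hH Hf] Eg; have [H' mH' HH'] := hardy_field_maximal hH.
by exists H'; split; [case: mH'|exact: HH'|exact: Eg].
Qed.

Lemma hardy_opp H f : hardy_field H -> H f -> H (fun x => - f x).
Proof.
move=> hH Hf; have := hardy_sub hH (hardy_sub hH Hf Hf) Hf.
by move/(hardy_saturated hH); apply; apply: nearW => x; rewrite subrr sub0r.
Qed.

Lemma hardy_exp H f n : hardy_field H -> H f -> H (fun x => f x ^+ n).
Proof.
move=> hH Hf; elim: n => [|n IH]; first exact: hardy_one hH.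
apply: (hardy_saturated hH (hardy_mul hH Hf IH)).
by apply: nearW => x; rewrite exprS.
Qed.

(** A nonzero germ is invertible, so it has no zeros near infinity; a continuous representative then
    keeps its sign by the intermediate value theorem. *)
Lemma hardy_sign H f : hardy_field H -> H f ->
  [\/ \forall x \near +oo, f x = 0, \forall x \near +oo, 0 < f x |
      \forall x \near +oo, f x < 0].
Proof.
move=> hH Hf.
have [f0|f0] := pselect (germ_eq f (fun=> 0)); first by constructor 1.
have [g _ fg] := hardy_inv hH Hf f0.
have [h ch fh] := hardy_continuous hH Hf.
have /near_pinftyP[M MP] : \forall x \near +oo, f x * g x = 1 /\ f x = h x.
  by near=> x; split; near: x.
have h_neq0 x : M <= x -> h x != 0.
  move=> /MP[+ <-]; apply: contraPneq => ->; rewrite mul0r => /eqP.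
  by rewrite eq_sym oner_eq0.
have [hM|hM] := ltP 0 (h M).
- constructor 2; apply/near_pinftyP; exists M => x Mx.
  have [_ ->] := MP _ Mx; rewrite ltNge; apply/negP => hx.
  have [|||c] := @IVT _ h M x 0 => //; first exact: continuous_subspaceT.
    by rewrite ge_min le_max hx (ltW hM) orbT.
  by rewrite in_itv/= => /andP[Mc _] hc; have := h_neq0 _ Mc; rewrite hc eqxx.
- constructor 3; apply/near_pinftyP; exists M => x Mx.
  have [_ ->] := MP _ Mx; rewrite ltNge; apply/negP => hx.
  have [|||c] := @IVT _ h M x 0 => //; first exact: continuous_subspaceT.
    by rewrite ge_min le_max hx hM orbT.
  by rewrite in_itv/= => /andP[Mc _] hc; have := h_neq0 _ Mc; rewrite hc eqxx.
Unshelve. all: by end_near. Qed.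

Lemma derivable_continuous_within f (M : R) :
  (forall x, M <= x -> derivable f x 1) -> {within `[M, +oo[, continuous f}.
Proof.
move=> df; apply: continuous_in_subspaceT => x.
rewrite inE/= in_itv/= andbT => Mx.
exact/differentiable_continuous/derivable1_diffP/df.
Qed.

(** The derivative is in [H], so it has an eventual sign; if it were negative, [f] would be bounded
    above near infinity. *)
Lemma hardy_cvgy_ndecr H f : hardy_field H -> H f ->
  f x @[x --> +oo] --> +oo ->
  \forall M \near +oo, forall x y, M <= x -> x <= y -> f x <= f y.
Proof.
move=> hH Hf foo; have [fder Hf'] := hardy_derive hH Hf.
suff f'ge0 : \forall x \near +oo, 0 <= derive1 f x.
  have /near_pinftyP[M MP] :
      \forall x \near +oo, derivable f x 1 /\ 0 <= derive1 f x.
    by near=> x; split; near: x.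
  apply/near_pinftyP; exists M => N MN x y Nx.
  apply: (@ger0_derive1_ndecry _ _ M); last exact: le_trans Nx.
  - by move=> z; rewrite in_itv/= andbT => /ltW /MP[].
  - by move=> z; rewrite in_itv/= andbT => /ltW /MP[].
  - by apply: derivable_continuous_within => z /MP[].
suff: ~ \forall x \near +oo, derive1 f x < 0.
  case: (hardy_sign hH Hf') => // H0 _; apply: filterS H0 => x; first by move->.
  exact: ltW.
move=> f'lt0.
have /near_pinftyP[M MP] : \forall x \near +oo, derivable f x 1 /\ derive1 f x < 0.
  by near=> x; split; near: x.
have fM x : M <= x -> f x <= f M.
  move=> Mx; apply: (@ler0_derive1_nincry _ _ M) => //.
  - by move=> z; rewrite in_itv/= andbT => /ltW /MP[].
  - by move=> z; rewrite in_itv/= andbT => /ltW /MP[_ /ltW].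
  - by apply: derivable_continuous_within => z /MP[].
have /near_pinftyP[N NP] : \forall x \near +oo, f M < f x.
  by move: foo => /cvgryPgt/(_ (f M)).
have := NP (Num.max M N); rewrite le_max lexx orbT => /(_ isT).
by rewrite ltNge fM// le_max lexx.
Unshelve. all: by end_near. Qed.

End HardyField.

(** * Growth of [W] compared with powers of [|a|] *)

Lemma le_absz_ceil (R : realType) (x : R) : x <= `|Num.ceil x|%N%:R.
Proof.
by rewrite natr_absz (le_trans (Num.Theory.ceil_ge x))// ler_int ler_norm.
Qed.

Lemma hardy_norm (R : realType) (H : set (R -> R)) (f : R -> R) :
  hardy_field H -> H f -> H (fun x => `|f x|).
Proof.
move=> hH Hf; have [f0|f0|f0] := hardy_sign hH Hf.
- apply: (hardy_saturated hH Hf); apply: filterS f0 => x ->.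
  by rewrite normr0.
- by apply: (hardy_saturated hH Hf); apply: filterS f0 => x /gtr0_norm.
- apply: (hardy_saturated hH (hardy_opp hH Hf)).
  by apply: filterS f0 => x /ltr0_norm.
Qed.

(** One term of the exponential series suffices: the one of index [n.+1], where
    [c * n.+1 >= C.+1]. *)
Lemma expR_powR_superpolynomial (R : realType) (c : R) (C : nat) : 0 < c ->
  exists2 e : R, 0 < e &
    forall y, 1 <= y -> e * y <= expR (y `^ c) / y ^+ C.
Proof.
move=> c0; pose n := `|Num.ceil (C.+1%:R / c)|%N.
exists (n.+1`!%:R)^-1 => [|y y1]; first by rewrite invr_gt0 ltr0n fact_gt0.
have y0 : 0 < y by exact: lt_le_trans y1.
rewrite ler_pdivlMr ?exprn_gt0// -mulrA -exprS.
have nC : C.+1%:R <= c * n.+1%:R.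
  rewrite mulrC -ler_pdivrMr//.
  by rewrite (le_trans (le_absz_ceil _))// ler_nat.
apply: (@le_trans _ _ ((n.+1`!%:R)^-1 * (y `^ c) ^+ n.+1)).
  rewrite ler_pM2l ?invr_gt0 ?ltr0n ?fact_gt0//.
  by rewrite -(powR_mulrn C.+1 (ltW y0)) -(powR_mulrn n.+1 (powR_ge0 y c)) -powRrM ler_powR.
rewrite mulrC (le_trans _ (expR_ge1Dxn n (powR_ge0 y c)))//.
by rewrite lerDr.
Qed.

(** The quotient lies in [H] and eventually exceeds a positive multiple of [f], so it tends to
    infinity. The exponent is a natural number because [H] contains the natural powers of [f], but
    perhaps not its real powers. *)
Lemma hardy_ratio_ndecr (R : realType) (H : set (R -> R)) (f W : R -> R)
    (c : R) (C : nat) :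
  hardy_field H -> H f -> H W -> f x @[x --> +oo] --> +oo -> 0 < c ->
  (\forall x \near +oo, expR (f x `^ c) <= W x) ->
  \forall M \near +oo, forall x y, M <= x -> x <= y ->
    W x / f x ^+ C <= W y / f y ^+ C.
Proof.
move=> hH Hf HW foo c0 fW.
have f1 : \forall x \near +oo, 1 <= f x by move: foo => /cvgryPge/(_ 1).
apply: (hardy_cvgy_ndecr hH).
  have [|g Hg fg] := hardy_inv hH (hardy_exp C hH Hf).
    move=> f0; have /near_pinftyP[M] :
        \forall x \near +oo, 1 <= f x /\ f x ^+ C = 0.
      by near=> x; split; near: x.
    move=> /(_ M (lexx _))[f1M /eqP].
    by rewrite expf_eq0 => /andP[_ /eqP fM]; move: f1M; rewrite fM ler10.
  apply: (hardy_saturated hH (hardy_mul hH HW Hg)).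
  near=> x; congr (_ * _).
  have f0x : 0 < f x by apply: (@lt_le_trans _ _ 1) => //; near: x.
  apply: (mulfI (lt0r_neq0 (exprn_gt0 C f0x))).
  by rewrite divff ?expf_neq0 ?lt0r_neq0//; near: x.
have [e e0 eP] := expR_powR_superpolynomial C c0.
apply/cvgryPge => A.
have fA : \forall x \near +oo, A / e <= f x by move: foo => /cvgryPge/(_ (A/e)).
near=> x.
have f1x : 1 <= f x by near: x.
apply: (@le_trans _ _ (e * f x)); first by rewrite mulrC -ler_pdivrMr//; near: x.
apply: (le_trans (eP _ f1x)); rewrite ler_pM2r ?invr_gt0 ?exprn_gt0//; last first.
  exact: lt_le_trans f1x.
by near: x.
Unshelve. all: by end_near. Qed.

(** * Concentration of the weights on windows *)

Section Window.
Context {R : realType}.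
(** In the application [A], [V], [w] and [k] are the values at integers of [|a|], [W], [W'] and the
    absolute value of the floor of [a]. *)
Variables (A V w : nat -> R) (k : nat -> nat) (n0 : nat).
Hypothesis A_ndecr : forall i j, (n0 <= i <= j)%N -> A i <= A j.
Hypothesis A_infty : A @ \oo --> +oo.
Hypothesis kA : forall n, (n0 <= n)%N -> `|(k n)%:R - A n| <= 1.
Hypothesis w_ge0 : forall n, (n0 <= n)%N -> 0 <= w n.
Hypothesis wV : forall n, (n0 <= n)%N -> w n.+1 <= V n.+1 - V n <= w n.
Hypothesis V_infty : V @ \oo --> +oo.
Hypothesis VA_ndecr : forall C, exists n1, forall i j, (n1 <= i <= j)%N ->
  V i / A i ^+ C <= V j / A j ^+ C.

Lemma weight_le n i : (n0 <= n)%N -> w (n + i) <= w n.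
Proof.
move=> nn; elim: i => [|i IH]; first by rewrite addn0.
rewrite addnS (le_trans _ IH)//.
by have /andP[/le_trans] := wV (leq_trans nn (leq_addr i n)); apply.
Qed.

(** By [wV], replacing the increment of [V] from [i] to [i.+1] by [w i.+1] costs at most
    [w i - w i.+1]. These errors telescope, so the bound is independent of [N]. *)
Lemma weight_sum_diff n N : (n0 <= n)%N -> (n <= N)%N ->
  `|\sum_(1 <= i < N.+1) w i - V N| <=
  \sum_(1 <= i < n.+1) `|w i| + `|V n| + w n.
Proof.
move=> nn /subnK <-; rewrite addnC; set j := (N - n)%N.
have S0 : `|\sum_(1 <= i < n.+1) w i| <= \sum_(1 <= i < n.+1) `|w i|.
  exact: ler_norm_sum.
suff /andP[lb ub] : w (n + j) - w n <=
    (\sum_(1 <= i < (n + j).+1) w i - \sum_(1 <= i < n.+1) w i)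
     - (V (n + j) - V n) <= 0.
  have wj : 0 <= w (n + j) by rewrite w_ge0// (leq_trans nn)// leq_addr.
  have w0 := w_ge0 nn.
  have := ler_norm (V n); have := ler_norm (- V n); rewrite normrN.
  move: S0; rewrite !ler_norml => /andP[? ?] ? ?; apply/andP; split; lra.
elim: j => [|j /andP[lb ub]]; first by rewrite addn0; apply/andP; split; lra.
rewrite addnS big_nat_recr//=.
have /andP[? ?] := wV (leq_trans nn (leq_addr j n)).
apply/andP; split; lra.
Qed.

(** Trailing indices failing [P] are dropped. At the last index [i] satisfying [P], even the full
    sum of weights from [n.+1] to [i] is at most [V i - V n], and [V i <= B]. *)
Lemma weight_sum_cond (P : pred nat) n N B : (n0 <= n)%N -> (n <= N)%N ->
  0 <= B -> (forall i, (n < i <= N)%N -> P i -> V i <= B) ->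
  \sum_(1 <= i < N.+1 | P i) `|w i| <=
  \sum_(1 <= i < n.+1) `|w i| + `|V n| + B.
Proof.
move=> nn /subnK <-; rewrite addnC; set j := (N - n)%N => B0.
have V0 := normr_ge0 (V n).
have PS m : \sum_(1 <= i < m | P i) `|w i| <= \sum_(1 <= i < m) `|w i|.
  by rewrite big_mkcond ler_sum// => i _; case: ifP.
elim: j => [_|j IH PB].
  by rewrite addn0 (le_trans (PS _))// -addrA lerDl addr_ge0.
case Pj : (P (n + j.+1)%N); last first.
  rewrite addnS in Pj *; rewrite big_mkcond big_nat_recr//= Pj addr0 -big_mkcond/=.
  apply: IH => i /andP[ni ij]; apply: PB.
  by rewrite ni addnS (leq_trans ij).
have VB : V (n + j.+1)%N <= B by apply: PB; rewrite ?Pj// leqnn andbT addnS ltnS leq_addr.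
apply: (le_trans (PS _)).
suff ub : \sum_(1 <= i < (n + j.+1).+1) `|w i| - \sum_(1 <= i < n.+1) `|w i|
    <= V (n + j.+1)%N - V n.
  by have := ler_norm (- V n); rewrite normrN; move: ub VB; lra.
move: (j.+1) => l; elim: l => [|l IHl]; first by rewrite addn0 !subrr.
rewrite addnS big_nat_recr//=.
have /andP[? ?] := wV (leq_trans nn (leq_addr l n)).
have : 0 <= w (n + l).+1 by rewrite w_ge0// ltnW// ltnS (leq_trans nn)// leq_addr.
by move=> /ger0_norm ->; lra.
Qed.

Lemma cvgy_threshold (u : nat -> R) (M : R) : u @ \oo --> +oo ->
  exists n, forall i, (n <= i)%N -> M <= u i.
Proof. by move=> /cvgryPge/(_ M)[n _ nP]; exists n. Qed.

Lemma window_dominates (p N0 : nat) : (0 < p)%N ->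
  exists2 l, (0 < l)%N & forall m, (p * l <= m <= 3 * (p * l))%N ->
    exists N, [/\ (N0 <= N)%N, 0 < V N,
      \sum_(1 <= n < N.+1 | ~~ [&& (n0 <= n)%N, (m < k n + l)%N & (k n <= m)%N])
         `|w n| <= V N / 8 &
      `|\sum_(1 <= n < N.+1) w n - V N| <= V N / 8].
Proof.
move=> p0; pose d : R := (6 * p%:R)^-1.
have p1 : 1 <= p%:R :> R by rewrite ler1n.
have d0 : 0 < d by rewrite invr_gt0; lra.
have d1 : d < 1 by rewrite invf_lt1; lra.
(* Every [m <= 3 * (p * l)] satisfies [d * m <= l / 2]: a window of length [l]
   ending at [m] starts below [(1 - d) * m], where [V] is 32 times smaller. *)
have [C dC] : exists C, (1 - d) ^+ C <= 32^-1.
  have : (1 - d) ^+ n @[n --> \oo] --> 0.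
    by apply: cvg_expr; rewrite ger0_norm; lra.
  move=> /cvgr_norm_le /(_ 32^-1).
  rewrite normr0 => /(_ _)[]; first by rewrite invr_gt0.
  by move=> C _ /(_ _ (leqnn _)); exists C; rewrite (le_trans (ler_norm _)).
have [n1 n1P] := VA_ndecr C.
have [na naP] := cvgy_threshold 1 A_infty.
have [nv nvP] := cvgy_threshold 1 V_infty.
pose n2 := maxn n0 (maxn n1 (maxn na nv)).
have [n02 n12 na2 nv2] : [/\ n0 <= n2, n1 <= n2, na <= n2 & nv <= n2]%N.
  by rewrite /n2; split; lia.
(* [K] bounds the contribution of the initial indices, uniformly in [N]. *)
pose K := \sum_(1 <= i < n2.+1) `|w i| + `|V n2| + w n2.
have w20 := w_ge0 n02.
have S0 : 0 <= \sum_(1 <= i < n2.+1) `|w i| + `|V n2|.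
  by rewrite addr_ge0// sumr_ge0.
have [nk nkP] := cvgy_threshold (64 * K) V_infty.
pose N3 := maxn N0 (maxn n2 nk).
have [N03 n23 nk3] : [/\ N0 <= N3, n2 <= N3 & nk <= N3]%N.
  by rewrite /N3; split; lia.
(* The 4 absorbs the rounding errors between [k] and [A]; the other term gives [A N3 <= m - 1], so
   that a suitable [N] exists beyond [N3]. *)
pose l := (4 + `|Num.ceil (A N3 + 1)|)%N.
have l4 : 4 <= l%:R :> R by rewrite ler_nat leq_addr.
have lA : A N3 + 1 <= l%:R.
  by rewrite (le_trans (le_absz_ceil _))// ler_nat leq_addl.
exists l => [|m /andP[]]; first by [].
rewrite -!(ler_nat R) !natrM => plm mpl.
(* The averages stop just before [A] exceeds [m - 1]: since [k] and [A] differ by at most 1,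
   [k i <= m] for all [i] from [n2] to [N], so only the lower end of the window can be missed. *)
have [N [N3N NA AN]] : exists N, [/\ (N3 <= N)%N, A N <= m%:R - 1 & m%:R - 1 < A N.+1].
  have ex : exists i, m%:R - 1 < A (N3 + i)%N.
    have [q qP] := cvgy_threshold (m%:R : R) A_infty.
    exists q; have := qP (N3 + q)%N (leq_addl _ _); lra.
  case: (ex_minnP ex) => [[|i]] iA imin.
    exfalso; move: iA; rewrite addn0.
    have : l%:R <= p%:R * l%:R :> R by rewrite ler_peMl//; lra.
    lra.
  exists (N3 + i)%N; split; [exact: leq_addr| |by rewrite -addnS].
  by rewrite leNgt; apply/negP => /imin; rewrite ltnn.
have n2N := leq_trans n23 N3N.
have VN1 : 1 <= V N by apply: nvP; exact: leq_trans nv2 n2N.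
have KN : 64 * K <= V N by apply: nkP; exact: leq_trans nk3 N3N.
exists N; split; [exact: leq_trans N3N|lra| |]; last first.
  by apply: le_trans (weight_sum_diff n02 n2N) _; rewrite -/K; lra.
(* With [VS] below, [V N.+1 <= V N + K]; so [V N.+1 / 32] plus the initial part stays below
   [V N / 8]. *)
have wN : w N <= w n2 by have := weight_le (N - n2) n02; rewrite subnKC.
have /andP[_ VS] := wV (leq_trans n02 n2N).
have VS1 : 1 <= V N.+1 by apply: nvP; exact: leq_trans nv2 (leqW n2N).
apply: le_trans (weight_sum_cond (B := V N.+1 / 32) n02 n2N _ _) _.
- lra.
- move=> i /andP[ni iN]; have n0i := leq_trans n02 (ltnW ni).
  have Ai : 1 <= A i by apply: naP; rewrite (leq_trans na2)// ltnW.
  have AS : 1 <= A N.+1 by apply: naP; rewrite (leq_trans na2)// ltnW.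
  have AiN : A i <= A N by apply: A_ndecr; rewrite n0i.
  have := kA n0i; rewrite ler_norml => /andP[kA1 kA2].
  have -> : (k i <= m)%N by rewrite -(ler_nat R); lra.
  rewrite n0i andbT /= -leqNgt -(ler_nat R) natrD => kl.
  have dm : d * m%:R <= l%:R / 2.
    by rewrite /d mulrC ler_pdivrMr; lra.
  have Ad : A i <= (1 - d) * A N.+1.
    have : (1 - d) * (m%:R - 1) <= (1 - d) * A N.+1 by rewrite ler_pM2l; lra.
    rewrite mulrBl !mulrBr mul1r !mulr1; lra.
  have := n1P i N.+1; rewrite (leq_trans n12 (ltnW ni)) (leqW iN) => /(_ isT).
  rewrite ler_pdivrMr ?exprn_gt0//; [|lra]; move=> /le_trans; apply.
  rewrite -mulrA ler_pM2l; [|lra]; rewrite mulrC ler_pdivrMr ?exprn_gt0//; [|lra].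
  apply: (@le_trans _ _ (((1 - d) * A N.+1) ^+ C)).
    by rewrite lerXn2r// nnegrE; lra.
  by rewrite exprMn ler_pM2r// exprn_gt0//; lra.
move: KN; rewrite /K; lra.
Qed.

End Window.

(** * A Rokhlin-type lemma for possibly noninvertible maps *)

Section WeakRokhlin.
Context {R : realType} {d : measure_display} {X : measurableType d}.
Variable mu : probability X R.
Implicit Types (T S : X -> X) (A B : set X).

Lemma measurable_iter T n : measurable_fun [set: X] T ->
  measurable_fun [set: X] (iter n T).
Proof.
move=> mT; elim: n => [|n IH]; first exact: measurable_id.
exact: (measurableT_comp mT IH).
Qed.

Lemma measurable_preimage_iter T n A : measurable_fun [set: X] T ->
  measurable A -> measurable (iter n T @^-1` A).
Proof.
by move=> mT mA; rewrite -[_ @^-1` _]setTI; exact: measurable_iter.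
Qed.

Lemma measure_preserving_iter T n : measure_preserving mu T ->
  measure_preserving mu (iter n T).
Proof.
move=> [mT muT]; split=> [|A mA]; first exact: measurable_iter.
elim: n => [//|n IH].
have -> : iter n.+1 T @^-1` A = T @^-1` (iter n T @^-1` A).
  by apply/seteqP; split=> x /=; rewrite -iterS iterSr.
by rewrite muT//; exact: measurable_preimage_iter.
Qed.

Lemma negligible_preimage T A : measure_preserving mu T ->
  mu.-negligible A -> mu.-negligible (T @^-1` A).
Proof.
move=> [mT muT] [N [mN N0 AN]]; exists (T @^-1` N); split.
- by rewrite -[_ @^-1` _]setTI; exact: mT.
- by rewrite muT.
- by move=> x /AN.
Qed.

Lemma measure_bigcap0_small (C : (set X)^nat) (e : R) :
  (forall n, measurable (C n)) ->
  (forall m n, (m <= n)%N -> C n `<=` C m) ->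
  mu (\bigcap_n C n) = 0%E -> 0 < e -> exists n, (mu (C n) <= e%:E)%E.
Proof.
move=> mC Cni C0 e0.
have : mu \o C @ \oo --> mu (\bigcap_n C n).
  apply: nonincreasing_cvg_mu => //.
  - by rewrite (le_lt_trans (probability_le1 _ _))// ltry.
  - exact: bigcap_measurable.
  - by move=> m n mn; apply/subsetPset/Cni.
rewrite C0 => /fine_cvgP[_ /cvgr0_norm_le/(_ _ e0)[n _ /(_ _ (leqnn _))/= Cn]].
exists n; rewrite -[mu (C n)]fineK ?fin_num_measure// lee_fin.
exact: le_trans (ler_norm _) Cn.
Qed.

(** At almost every [x], [phi] takes values on the first [h] iterates different from [phi x], so a
    fine enough grid on the line separates them from [phi x]. The sets [B j] enumerate the inverse
    images of grid intervals, deprived of the points returning within time [h]; they cover almost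
    everything, and finitely many cover all but [e]. *)
Lemma separating_cells T h (e : R) :
  lebesgue_space mu -> measure_preserving mu T -> aperiodic mu T -> 0 < e ->
  exists (B : (set X)^nat) (J : nat),
    [/\ forall j, measurable (B j),
        forall j i x, (0 < i <= h)%N -> B j x -> ~ B j (iter i T x) &
        (mu (~` \bigcup_(j in `I_J) B j) <= e%:E)%E].
Proof.
move=> [phi [psi [mphi _ _ psiphi _]]] mpT apT e0.
pose cell (c : nat * int) :=
  [set x | c.2%:~R <= c.1%:R * phi x < c.2%:~R + 1].
pose B j : set X := if unpickle j is Some c
  then cell c `\` \bigcup_(i in `I_h) iter i.+1 T @^-1` cell c else set0.
have mcell c : measurable (cell c).
  have mf : measurable_fun [set: X] (fun x => c.1%:R * phi x).
    by apply: measurable_funM => //; exact: measurable_cst.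
  rewrite (_ : cell c =
      setT `&` (fun x => c.1%:R * phi x) @^-1` `[c.2%:~R, c.2%:~R + 1[).
    exact: mf.
  by rewrite setTI; apply/seteqP; split=> x /=; rewrite in_itv.
have mB j : measurable (B j).
  rewrite /B; case: (unpickle j) => // c; apply: measurableD => //.
  apply: bigcup_measurable => i _.
  by apply: measurable_preimage_iter => //; case: mpT.
have Binj j i x : (0 < i <= h)%N -> B j x -> ~ B j (iter i T x).
  rewrite /B; case: (unpickle j) => // c /andP[i0 ih] [_ nx] [cx _].
  by apply: nx; exists i.-1; rewrite /mkset prednK.
have mC n : measurable (~` \bigcup_(j in `I_n) B j).
  by apply: measurableC; exact: bigcup_measurable.
exists B; have [||J JB] := @measure_bigcap0_small _ e mC _ _ e0.
- by move=> m n mn x nB [j jm Bj]; apply: nB; exists j => //; exact: leq_trans mn.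
- apply/measure_negligible; first exact: bigcap_measurable.
  pose Z i := iter i T @^-1` [set x | psi (phi x) <> x].
  apply: (@negligibleS _ _ _ mu (\bigcup_i Z i `|`
      [set x | exists2 n, (0 < n)%N & iter n T x = x])); last first.
    apply: negligibleU => //; apply: negligible_bigcup => i.
    exact/negligible_preimage/psiphi/measure_preserving_iter.
  move=> x nB; apply: contrapT => /not_orP[nZ nper].
  have phi_inj i : (0 < i)%N -> phi (iter i T x) != phi x.
    move=> i0; apply/eqP => eqphi; apply: nper; exists i => //.
    have psiK l : psi (phi (iter l T x)) = iter l T x.
      by apply: contrapT => nK; apply: nZ; exists l.
    by rewrite -psiK eqphi (psiK 0).
  (* The mesh [1 / n] must be at most each of the [h] distances. *)
  have [n nP] : exists n, forall i, (0 < i <= h)%N ->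
      1 <= n%:R * `|phi (iter i T x) - phi x|.
    elim: h {B mB Binj mC nB} => [|l [n nP]].
      by exists 0 => -[].
    have dl : 0 < `|phi (iter l.+1 T x) - phi x|.
      by rewrite normr_gt0 subr_eq0 phi_inj.
    pose D := `|phi (iter l.+1 T x) - phi x|; pose n' := `|Num.ceil D^-1|%N.
    exists (maxn n n') => i /andP[i0]; rewrite leq_eqVlt => /orP[/eqP ->|il].
      rewrite -ler_pdivrMr// mul1r (le_trans (le_absz_ceil _))//.
      by rewrite ler_nat leq_maxr.
    rewrite (le_trans (nP i _)) ?i0// ler_wpM2r// ler_nat leq_maxl//.
  pose c := (n, Num.floor (n%:R * phi x)).
  have cx : cell c x.
    by rewrite /cell/= floor_le_tmp; have := floorD1_gt (n%:R * phi x); rewrite intrD.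
  apply: (nB (pickle c).+1 I); exists (pickle c) => //=.
  rewrite /B pickleK; split=> // -[i /= ih].
  move=> /andP[]; move: cx => /andP[/=].
  have := nP i.+1 ih; have [le|lt] := leP (phi (iter i.+1 T x)) (phi x).
    rewrite ler0_norm ?subr_le0// mulrN mulrBr; lra.
  rewrite gtr0_norm ?subr_gt0// mulrBr; lra.
- by exists J.
Qed.

(* [marker T h B j x] means that the [j * h]-th point of the orbit of [x] is
   selected in one of the first [j] rounds, where round [j] greedily selects the
   points of [B j] at distance more than [h] from all points selected before.
   Starting [j * h] steps ahead makes both directions of time visible although
   [T] need not be invertible. *)
Fixpoint marker T h (B : (set X)^nat) j : set X :=
  if j is j'.+1 then
    iter h T @^-1` marker T h B j' `|`
    (iter (j'.+1 * h) T @^-1` B j' `\`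
      \bigcup_(i in `I_(2 * h).+1) iter i T @^-1` marker T h B j')
  else set0.

Lemma measurable_marker T h (B : (set X)^nat) j : measurable_fun [set: X] T ->
  (forall j, measurable (B j)) -> measurable (marker T h B j).
Proof.
move=> mT mB; elim: j => [|j IH] /=; first exact: measurable0.
apply: measurableU; first exact: measurable_preimage_iter.
apply: measurableD; first exact: measurable_preimage_iter.
by apply: bigcup_measurable => i _; exact: measurable_preimage_iter.
Qed.

(** A point selected in the current round sits at time [h] relative to the earlier selection, so
    excluding the times from 0 to [2 * h] keeps it more than [h] away on both sides. Two points
    selected in the same round are separated by the assumption on [B j]. *)
Lemma marker_separated T h (B : (set X)^nat) :
  (forall j i x, (0 < i <= h)%N -> B j x -> ~ B j (iter i T x)) ->
  forall j i x, (0 < i <= h)%N -> marker T h B j x ->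
    ~ marker T h B j (iter i T x).
Proof.
move=> BP; elim=> [//|j IH] i x /andP[i0 ih] [A1|[B1 n1]] [A2|[B2 n2]].
- apply: (IH i (iter h T x)) => //; first by rewrite i0.
  by rewrite -iterD addnC iterD.
- apply: n2; exists (h - i)%N => /=; first lia.
  by rewrite -iterD subnK.
- apply: n1; exists (h + i)%N => /=; first lia.
  by rewrite iterD.
- apply: (BP j i (iter (j.+1 * h) T x)) => //; first by rewrite i0.
  by rewrite -iterD addnC iterD.
Qed.

(** In round [j] the given point of [B j] is either selected or blocked by a selected point within
    distance [h]. *)
Lemma marker_recurrent T h (B : (set X)^nat) J j x : (j < J)%N ->
  B j (iter (J.+1 * h) T x) ->
  exists2 i, (i <= 2 * h)%N & marker T h B J (iter i T x).
Proof.
move=> jJ Bj.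
(* Selected points stay selected, while each round moves the base point back by [h]. *)
have climb n i y : marker T h B n (iter (i * h) T y) -> marker T h B (n + i) y.
  elim: i n => [|i IH] n; first by rewrite addn0.
  by move=> Mn; rewrite -addSnnS; apply: IH; left; rewrite /= -iterD -mulSn.
have [[i ih Mi]|nM] := pselect
    ((\bigcup_(i in `I_(2 * h).+1) iter i T @^-1` marker T h B j)
      (iter ((J - j) * h) T x)).
  exists i => //; rewrite -(subnKC (ltnW jJ)); apply: climb.
  by move: Mi; rewrite /= -!iterD addnC.
exists h; first by rewrite leq_pmull.
rewrite -(subnKC jJ); apply: climb; right; split.
  by rewrite /= -!iterD ?addnA -mulnDl subnKC// -mulSnr.
by rewrite -iterD -mulSnr -subSn.
Qed.

(** The first [h.+1] preimages of [A] are disjoint and have equal measure. *)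
Lemma separated_measure_le T h A : measure_preserving mu T -> measurable A ->
  (forall i x, (0 < i <= h)%N -> A x -> ~ A (iter i T x)) ->
  (mu A <= (h.+1%:R^-1)%:E)%E.
Proof.
move=> mpT mA sepA.
have mF i : measurable (iter i T @^-1` A).
  by apply: measurable_preimage_iter => //; case: mpT.
have tF : trivIset [set: 'I_h.+1] (fun i : 'I_h.+1 => iter i T @^-1` A).
  have sep (i j : 'I_h.+1) x : (i < j)%N ->
      A (iter i T x) -> ~ A (iter j T x).
    move=> ij Ai; have jh := ltn_ord j.
    rewrite -(subnK (ltnW ij)) iterD; apply: sepA => //.
    rewrite subn_gt0 ij /=; lia.
  move=> i j _ _ [x [/= Ai Aj]]; apply/val_inj/eqP.
  case: ltngtP => // [ij|ji]; first by have := sep _ _ _ ij Ai.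
  by have := sep _ _ _ ji Aj.
have := @measure_bigsetU_ord _ _ _ mu h.+1 xpredT _ (fun i => mF i) tF.
rewrite (eq_bigr (fun=> mu A)) => [|i _]; last first.
  exact: (measure_preserving_iter i mpT).2.
move=> muU; have : (\sum_(i < h.+1) mu A <= 1)%E.
  by rewrite -muU probability_le1//; exact: bigsetU_measurable.
rewrite -[mu A]fineK ?fin_num_measure// sumEFin lee_fin sumr_const card_ord.
by rewrite lee_fin -[fine _ *+ _]mulr_natl -ler_pdivlMl// mulr1.
Qed.

Lemma weak_rokhlin T h (e : R) :
  lebesgue_space mu -> measure_preserving mu T -> aperiodic mu T -> 0 < e ->
  exists A, [/\ measurable A, (mu A <= (h.+1%:R^-1)%:E)%E &
    (mu (~` \bigcup_(i in `I_(2 * h).+1) iter i T @^-1` A) <= e%:E)%E].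
Proof.
move=> lX mpT apT e0.
have [B [J [mB BP BJ]]] := separating_cells h lX mpT apT e0.
have mT : measurable_fun [set: X] T by case: mpT.
have mM := measurable_marker h J mT mB.
exists (marker T h B J); split=> //.
  apply: (separated_measure_le mpT) => // i x; exact: marker_separated.
have mC : measurable (~` \bigcup_(j in `I_J) B j).
  by apply: measurableC; exact: bigcup_measurable.
have [_ mpJ] := measure_preserving_iter (J.+1 * h) mpT.
(* By [marker_recurrent], the iterate of order [J.+1 * h] of an uncovered point avoids the first [J]
   cells; invariance of [mu] concludes. *)
apply: le_trans BJ; rewrite -(mpJ _ mC) le_measure ?inE//.
- apply: measurableC; apply: bigcup_measurable => i _.
  exact: measurable_preimage_iter.
- exact: measurable_preimage_iter.
move=> x nM [j jJ Bj]; apply: nM.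
by have [i ih Mi] := marker_recurrent jJ Bj; exists i.
Qed.

End WeakRokhlin.

(** * From detection at every scale to divergence almost everywhere *)

Section Divergence.
Context {R : realType} {d : measure_display} {X : measurableType d}.
Variables (mu : probability X R) (T : X -> X).
Hypothesis mpT : measure_preserving mu T.

Lemma measurable_bigcup_iter n (F : set X) : measurable F ->
  measurable (\bigcup_(i in `I_n) iter i T @^-1` F).
Proof.
move=> mF; apply: bigcup_measurable => i _.
by apply: measurable_preimage_iter => //; case: mpT.
Qed.

Lemma measure_bigcup_iter_le n (F : set X) : measurable F ->
  (mu (\bigcup_(i in `I_n) iter i T @^-1` F) <= (n%:R * fine (mu F))%:E)%E.
Proof.
move=> mF; rewrite bigcup_mkord.
have mFi i : (i < n)%N -> measurable (iter i T @^-1` F).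
  by move=> _; apply: measurable_preimage_iter => //; case: mpT.
apply: (le_trans (Boole_inequality mu mFi)).
rewrite (eq_bigr (fun=> mu F)) => [|i _]; last first.
  exact: (measure_preserving_iter i mpT).2.
rewrite -[mu F]fineK ?fin_num_measure// sumEFin lee_fin sumr_const card_ord.
by rewrite mulr_natl.
Qed.

Lemma oscillation_not_cvg (u : nat -> R) n0 :
  (forall j, (n0 <= j)%N ->
    exists2 N, (j <= N)%N & `|u N - (odd j)%:R| <= 4^-1) ->
  ~ cvgn u.
Proof.
move=> osc /cvg_ex[/= l /cvgrPdist_le ul].
have [|n1 _ n1P] := ul 8^-1; first by rewrite invr_gt0 ltr0n.
pose j := ((n0 + n1).*2)%N.
have [|N0 jN0 uN0] := osc j; first by rewrite /j; lia.
have [|N1 jN1 uN1] := osc j.+1; first by rewrite /j; lia.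
have := n1P N0; have := n1P N1; rewrite /mkset.
move=> /(_ ltac:(rewrite /j in jN1; lia)) + /(_ ltac:(rewrite /j in jN0; lia)).
move: uN0 uN1.
rewrite /= [odd j]odd_double /= !ler_norml => /andP[? ?] /andP[? ?] /andP[? ?] /andP[? ?].
lra.
Qed.

Variable avg : (X -> R) -> X -> nat -> R.

(** [N] is chosen before [E] and [b], so the set [E] may be built later: only its values on [F]
    along the first [M] iterates matter. *)
Definition detects (F D : set X) (M N0 : nat) : Prop :=
  forall x, ~ D x -> exists2 N, (N0 <= N)%N &
    forall (E : set X) (b : bool),
      (forall k, (k <= M)%N -> F (iter k T x) -> \1_E (iter k T x) = b%:R :> R) ->
      `|avg \1_E x N - b%:R| <= 4^-1.

Lemma divergence_of_detection :
  (forall (e : R) N0, 0 < e -> exists F D M,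
    [/\ measurable F, measurable D, (mu F <= e%:E)%E, (mu D <= e%:E)%E &
        detects F D M N0]) ->
  exists2 E, measurable E & {ae mu, forall x, ~ cvgn (avg \1_E x)}.
Proof.
move=> stage.
have [S SP] : {S : {posnum R} * nat -> set X * set X * nat & forall c,
    [/\ measurable (S c).1.1, measurable (S c).1.2,
        (mu (S c).1.1 <= c.1%:num%:E)%E, (mu (S c).1.2 <= c.1%:num%:E)%E &
        detects (S c).1.1 (S c).1.2 (S c).2 c.2]}.
  apply: (@choice _ _ (fun c s => [/\ measurable s.1.1, measurable s.1.2,
    (mu s.1.1 <= c.1%:num%:E)%E, (mu s.1.2 <= c.1%:num%:E)%E &
    detects s.1.1 s.1.2 s.2 c.2])) => -[e N0].
  have [F [D [M ?]]] := stage e%:num N0 ltac:(done).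
  by exists (F, D, M).
have epos (j M : nat) : 0 < (1 / (2 ^ j.+1)%:R) / M.+2%:R :> R.
  by rewrite !divr_gt0// ltr0n expn_gt0.
pose e j M := PosNum (epos j M).
(* [M j] bounds the iterates inspected in the stages before [j]; the factor
   [(M j).+2] makes [F j] invisible to them up to measure [2 ^- j.+1]. *)
pose M := fix M j := if j is j'.+1 then maxn (M j') (S (e j' (M j'), j')).2 else 0%N.
pose s j := S (e j (M j), j).
pose F j := (s j).1.1; pose D j := (s j).1.2.
have sP j : [/\ measurable (F j), measurable (D j),
    (mu (F j) <= (e j (M j))%:num%:E)%E, (mu (D j) <= (e j (M j))%:num%:E)%E &
    detects (F j) (D j) (s j).2 j] := SP _.
have Mndecr i j : (i <= j)%N -> (M i <= M j)%N.
  elim: j => [|j IH]; first by rewrite leqn0 => /eqP ->.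
  by rewrite leq_eqVlt => /orP[/eqP ->//|/IH/leq_trans]; apply; exact: leq_maxl.
(* The bad points of stage [j]: those where detection fails, and those where [F j] could spoil an
   earlier stage. *)
pose D' j := D j `|` \bigcup_(k in `I_(M j).+1) iter k T @^-1` F j.
have mD' j : measurable (D' j).
  by have [mF mD _ _ _] := sP j; apply: measurableU => //; exact: measurable_bigcup_iter.
have muD' j : (mu (D' j) <= (1 / (2 ^ j.+1)%:R)%:E)%E.
  have [mF mD muF muD _] := sP j.
  apply: le_trans (measureU2 _ _ _) _ => //; first exact: measurable_bigcup_iter.
  apply: le_trans (leeD muD (measure_bigcup_iter_le _ mF)) _.
  have : fine (mu (F j)) <= (e j (M j))%:num.
    by rewrite -lee_fin fineK// fin_num_measure.
  rewrite -EFinD lee_fin => Fe.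
  apply: (@le_trans _ _ ((M j).+2%:R * (e j (M j))%:num)).
    rewrite -[in leRHS]add1n natrD mulrDl mul1r lerD2l ler_wpM2l//.
  by rewrite /= mulrC divfK// pnatr_eq0.
have D'0 : mu (lim_sup_set D') = 0%E.
  apply: lim_sup_set_cvg0 => //.
  apply: (@le_lt_trans _ _ (\sum_(j <oo) (1 / (2 ^ j.+1)%:R)%:E)%E).
    by apply: lee_nneseries => // j _; exact: muD'.
  by apply: le_lt_trans (epsilon_trick0 xpredT ler01) _; rewrite ltry.
have mlim : measurable (lim_sup_set D').
  by apply: bigcap_measurable => // n _; exact: bigcup_measurable.
(* The indicator function of [\bigcup_j G j] is, at each point, the parity of the
   last [j] such that [F j] contains the point. *)
pose G j := if odd j then F j `\` \bigcup_(i in [set i | (j < i)%N]) F i else set0.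
have mF j : measurable (F j) by case: (sP j).
exists (\bigcup_j G j).
  apply: bigcupT_measurable => j; rewrite /G; case: ifP => // _.
  by apply: measurableD => //; exact: bigcup_measurable.
exists (lim_sup_set D'); split=> // x /= /contrapT cx; apply: contrapT => nx.
have [j0 j0P] : exists j0, forall j, (j0 <= j)%N -> ~ D' j x.
  apply: contrapT => /forallNP nj; apply: nx => n _.
  have /existsNP[j /not_implyP[nj' /contrapT Dj]] := nj n.
  by exists j.
move: cx; apply: (@oscillation_not_cvg _ j0) => j j0j.
have [_ _ _ _ det] := sP j.
have [|N jN NP] := det x; first by move=> Dx; apply: (j0P _ j0j); left.
exists N => //; apply: NP => k kM Fk.
(* Hence [j] is the last stage whose set contains this iterate, and its parity decides the value. *)
have later i : (j < i)%N -> ~ F i (iter k T x).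
  move=> ji Fi; apply: (j0P i (leq_trans j0j (ltnW ji))); right; exists k => //=.
  rewrite ltnS (leq_trans kM)// (leq_trans _ (Mndecr _ _ ji))//.
  exact: leq_maxr.
rewrite indicE; congr (_%:R); case oj : (odd j).
  rewrite mem_set//; exists j => //; rewrite /G oj; split=> // -[i /= ji].
  exact: later.
rewrite memNset// => -[i _]; rewrite /G; case oi : (odd i) => // -[Fi nlater].
have [ij|ji|ij] := ltngtP i j.
- by apply: nlater; exists j.
- exact: later Fi.
- by rewrite ij oj in oi.
Qed.

End Divergence.

(** * Detection by windows of the orbit *)

Section Detection.
Context {R : realType} {d : measure_display} {X : measurableType d}.
Variables (mu : probability X R) (T : X -> X).
Variables (theta : nat -> X -> X) (k : nat -> nat) (w V : nat -> R) (n0 : nat).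
Hypothesis lX : lebesgue_space mu.
Hypothesis mpT : measure_preserving mu T.
Hypothesis apT : aperiodic mu T.
Hypothesis thetaE : forall n, (n0 <= n)%N -> theta n = iter (k n) T.
Hypothesis window : forall p N0, (0 < p)%N ->
  exists2 l, (0 < l)%N & forall m, (p * l <= m <= 3 * (p * l))%N ->
    exists N, [/\ (N0 <= N)%N, 0 < V N,
      \sum_(1 <= n < N.+1 | ~~ [&& (n0 <= n)%N, (m < k n + l)%N & (k n <= m)%N])
         `|w n| <= V N / 8 &
      `|\sum_(1 <= n < N.+1) w n - V N| <= V N / 8].

Let avg (f : X -> R) x N := (V N)^-1 * \sum_(1 <= n < N.+1) w n * f (theta n x).

(** Off [D], the orbit meets [A] at a time [m] between [h] and [3 * h], and [F] contains the
    iterates of orders in the window of length [l] ending at [m]. As [h = p * l], the measure of [F]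
    is at most [l / h.+1], which is below [1 / p <= e]. *)
Lemma detection (e : R) N0 : 0 < e -> exists F D M,
  [/\ measurable F, measurable D, (mu F <= e%:E)%E, (mu D <= e%:E)%E &
      detects T avg F D M N0].
Proof.
move=> e0; pose p := `|Num.ceil e^-1|.+1%N.
have pe : e^-1 <= p%:R.
  by rewrite (le_trans (le_absz_ceil _))// ler_nat leqnSn.
have [l l0 lP] := window N0 (isT : (0 < p)%N).
pose h := (p * l)%N.
have [A [mA muA hitA]] := weak_rokhlin h lX mpT apT e0.
have mT : measurable_fun [set: X] T by case: mpT.
exists (\bigcup_(i in `I_l) iter i T @^-1` A).
(* The shift by [h] rules out hitting times below [h], for which [window] gives nothing. *)
exists (iter h T @^-1` ~` \bigcup_(i in `I_(2 * h).+1) iter i T @^-1` A).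
have mhit : measurable (~` \bigcup_(i in `I_(2 * h).+1) iter i T @^-1` A).
  by apply: measurableC; exact: (measurable_bigcup_iter mpT).
exists (3 * h)%N; split.
- exact: (measurable_bigcup_iter mpT).
- exact: measurable_preimage_iter.
- apply: le_trans (measure_bigcup_iter_le mpT l mA) _.
  rewrite lee_fin; have : fine (mu A) <= h.+1%:R^-1.
    by rewrite -lee_fin fineK// fin_num_measure.
  rewrite -[leRHS]mul1r ler_pdivlMr// => Ah.
  have l0' : 0 < l%:R :> R by rewrite ltr0n.
  have A0 : 0 <= fine (mu A) by rewrite fine_ge0.
  have : fine (mu A) * (e^-1 * l%:R) <= 1.
    apply: le_trans Ah; rewrite ler_wpM2l// (@le_trans _ _ (p%:R * l%:R))//.
      by rewrite ler_pM2r.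
    by rewrite -natrM ler_nat leqnSn.
  by rewrite mulrCA ler_pdivrMl// mulr1 mulrC.
- by rewrite (measure_preserving_iter h mpT).2.
move=> x /= /contrapT[i ih /= Ai].
have [|N [N0N VN offN totN]] := lP (i + h)%N; first by rewrite -/h; move: ih => /=; lia.
exists N => // E b Eb.
have ind_le (c : X) : `|\1_E c - b%:R| <= 1 :> R.
  by rewrite indicE; case: (c \in E); case: b {Eb};
    rewrite ?subr0 ?subrr ?sub0r ?normrN ?normr0 ?normr1.
have offE : `|\sum_(1 <= n < N.+1) w n * (\1_E (theta n x) - b%:R)| <= V N / 8.
  apply: le_trans offN; apply: le_trans (ler_norm_sum _ _ _) _.
  rewrite [leRHS]big_mkcond; apply: ler_sum => n _.
  case: ifPn => [_|]; first by rewrite normrM ler_piMr.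
  rewrite negbK => /and3P[n0n klo khi]; rewrite thetaE// Eb ?subrr ?mulr0 ?normr0//.
    by move: ih => /=; lia.
  exists (i + h - k n)%N => /=; first lia.
  by rewrite -iterD subnK// iterD.
(* The deviation splits into the terms outside the window and the defect of the total weight; each
   is at most [V N / 8], whence 1/4. *)
have -> : avg \1_E x N - b%:R = (V N)^-1 *
   (\sum_(1 <= n < N.+1) w n * (\1_E (theta n x) - b%:R)
    + b%:R * (\sum_(1 <= n < N.+1) w n - V N)).
  under [in RHS]eq_bigr do rewrite mulrBr.
  rewrite sumrB -mulr_suml /avg; field; exact: lt0r_neq0.
rewrite normrM ger0_norm; last by rewrite invr_ge0 ltW.
rewrite ler_pdivrMl//.
apply: le_trans (ler_normD _ _) _; rewrite normrM.
have : `|b%:R| * `|\sum_(1 <= n < N.+1) w n - V N| <= V N / 8.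
  by rewrite (le_trans _ totN)// ler_piMl//; case: b {Eb ind_le offE}; rewrite ?normr1 ?normr0.
move: offE; lra.
Qed.

End Detection.

(** * Bounded test functions and almost everywhere inverses *)

Lemma indic_Lfun_oo (R : realType) (d : measure_display)
    (X : measurableType d) (mu : probability X R) (E : set X) :
  measurable E -> (\1_E : X -> R) \in Lfun mu +oo%E.
Proof.
move=> mE; apply/andP; split.
  by rewrite inE/=; exact: measurable_indic.
rewrite inE/= /finite_norm unlock; case: ifPn => // _.
apply: (@le_lt_trans _ _ 1%E); last by rewrite ltry.
apply/ess_supP/aeW => x /=; rewrite lee_fin indicE.
by case: (x \in E); rewrite ?normr1 ?normr0.
Qed.

Lemma le_measure_negligibleD (R : realType) (d : measure_display)
    (X : measurableType d) (mu : probability X R) (A B : set X) :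
  measurable A -> measurable B -> mu.-negligible (A `\` B) ->
  (mu A <= mu B)%E.
Proof.
move=> mA mB [N [mN N0 AN]].
apply: (@le_trans _ _ (mu (B `|` N))).
  rewrite le_measure ?inE//; first exact: measurableU.
  by move=> x Ax; have [Bx|nB] := pselect (B x); [left|right; exact: AN].
apply: le_trans (measureU2 _ mB mN) _.
rewrite [X in (_ + X)%E](_ : _ = 0%E) ?adde0//; exact: N0.
Qed.

Section AEInverse.
Context {R : realType} {d : measure_display} {X : measurableType d}.
Variables (mu : probability X R) (T S : X -> X).
Hypothesis mpT : measure_preserving mu T.
Hypothesis TS : ae_inverse mu T S.

Lemma ae_inverse_measure_preserving : measure_preserving mu S.
Proof.
case: mpT TS => mT muT [mS ST _]; split=> // A mA.
have mSA : measurable (S @^-1` A) by rewrite -[_ @^-1` _]setTI; exact: mS.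
have mTSA : measurable (T @^-1` (S @^-1` A)).
  by rewrite -[_ @^-1` _]setTI; exact: mT.
apply: etrans (esym (muT _ mSA)) _; apply/eqP; rewrite eq_le.
apply/andP; split; apply: le_measure_negligibleD => //; apply: negligibleS ST.
- by move=> x [SA nA] /= eqx; apply: nA; move: SA => /=; rewrite eqx.
- by move=> x [Ax nSA] /= eqx; apply: nSA; rewrite /= eqx.
Qed.

(** Almost everywhere [T] undoes every iterate of [S], so a periodic point of [S] is periodic for
    [T] with the same period. *)
Lemma ae_inverse_aperiodic : aperiodic mu T -> aperiodic mu S.
Proof.
move=> apT; have [mT _] := mpT; have [mS ST TSx] := TS.
have mpS := ae_inverse_measure_preserving.
pose Z n := iter n S @^-1` [set x | T (S x) <> x].
apply: (@negligibleS _ _ _ mu ((\bigcup_n Z n) `|`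
    [set x | exists2 n, (0 < n)%N & iter n T x = x])); last first.
  apply: negligibleU => //; apply: negligible_bigcup => n.
  exact/negligible_preimage/TSx/measure_preserving_iter.
move=> x [n n0 Sx]; apply: contrapT => /not_orP[nZ]; apply; exists n => //.
have TSn i : iter i T (iter i S x) = x.
  elim: i => // i IH; rewrite iterSr iterS [T (S _)](_ : _ = iter i S x)//.
  by apply: contrapT => nTS; apply: nZ; exists i.
by rewrite -{1}Sx TSn.
Qed.

End AEInverse.

(** * Passage to integers and conclusion *)

Lemma derivable_increment_bounds (R : realType) (W : R -> R) (x y : R) :
  x < y -> (forall z, x <= z <= y -> derivable W z 1) ->
  (forall u v, x <= u -> u <= v -> derive1 W v <= derive1 W u) ->
  derive1 W y * (y - x) <= W y - W x <= derive1 W x * (y - x).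
Proof.
move=> xy dW W'ni.
have [||z zxy ->] := @MVT R W (derive1 W) x y xy.
- move=> z; rewrite in_itv/= => /andP[xz zy].
  have dz : derivable W z 1 by apply: dW; rewrite !ltW.
  by rewrite derive1E; exact: derivableP.
- apply: derivable_within_continuous => z; rewrite in_itv/=; exact: dW.
move: zxy; rewrite in_itv/= => /andP[xz zy].
by rewrite !ler_pM2r ?subr_gt0// !W'ni// ltW.
Qed.

Lemma absz_floor_dist (R : realType) (x : R) :
  `|(`|Num.floor x|%N)%:R - `|x| | <= 1.
Proof.
rewrite natr_absz intr_norm (le_trans (ler_dist_dist _ _))//.
rewrite ler_norml; have := floor_le_tmp x; have := floorD1_gt x.
by rewrite intrD => ? ?; apply/andP; split; lra.
Qed.

Theorem theorem1p4 (R : realType) (a W : R -> R)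
  (aU : hardy_U a)
  (a_infty : `|a x| @[x --> +oo] --> +oo)
  (a_small : a x / x @[x --> +oo] --> (0 : R))
  (WE : hardy_E W)
  (w_pos : \forall x \near +oo, 0 < derive1 W x)
  (w_nincr : \forall M \near +oo,
     forall x y, M <= x -> x <= y -> derive1 W y <= derive1 W x)
  (W_infty : W x @[x --> +oo] --> +oo)
  (W_large : exists2 c : R, 0 < c &
     \forall x \near +oo, expR (`|a x| `^ c) <= W x) :
  pointwise_bad +oo a W.
Proof.
have [H [hH Ha HW]] := hardy_U_E aU WE.
have HA := hardy_norm hH Ha.
have [c c0 Wc] := W_large.
have [dW _] := hardy_derive hH HW.
move=> d X mu T S lX mpT apT TS.
pose k n := `|Num.floor (a n%:R)|%N.
pose theta n := int_iter T S (Num.floor (a n%:R)).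
(* By the eventual sign of [a], the iterates are eventually nonnegative powers of a single map [Q],
   either [T] or its inverse [S]. *)
have [Q [mpQ apQ thetaE]] : exists Q : X -> X,
    [/\ measure_preserving mu Q, aperiodic mu Q &
        \forall x \near +oo, forall n, x <= n%:R :> R -> theta n = iter (k n) Q].
  have a_neq0 : ~ \forall x \near +oo, a x = 0.
    move=> a0; have : \forall x \near +oo, 1 <= `|a x|.
      by move: a_infty => /cvgryPge/(_ 1).
    move=> a1; have /near_pinftyP[M /(_ M (lexx _))[+ aM]] :
        \forall x \near +oo, 1 <= `|a x| /\ a x = 0.
      by near=> x; split; near: x.
    by rewrite aM normr0 ler10.
  have [//|apos|aneg] := hardy_sign hH Ha.
  - exists T; split=> //; have /near_pinftyP[M MP] := apos.
    apply/near_pinftyP; exists M => x Mx n xn.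
    have : 0 <= Num.floor (a n%:R).
      by rewrite floor_ge0 ltW// MP// (le_trans Mx).
    by rewrite /theta /k; case: (Num.floor _).
  - exists S; have invS := TS aneg; split.
    + exact: (ae_inverse_measure_preserving mpT invS).
    + exact: (ae_inverse_aperiodic mpT invS).
    have /near_pinftyP[M MP] := aneg.
    apply/near_pinftyP; exists M => x Mx n xn.
    have : Num.floor (a n%:R) < 0.
      by rewrite floor_lt0 MP// (le_trans Mx).
    by rewrite /theta /k; case: (Num.floor _).
have A_ndecr := hardy_cvgy_ndecr hH HA a_infty.
have /near_pinftyP[x0 x0P] : \forall x \near +oo,
    [/\ forall n, x <= n%:R :> R -> theta n = iter (k n) Q,
        forall y z, x <= y -> y <= z -> `|a y| <= `|a z|,
        derivable W x 1, 0 < derive1 W x &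
        forall y z, x <= y -> y <= z -> derive1 W z <= derive1 W y].
  by near=> x; split; near: x.
pose n0 := `|Num.ceil x0|%N.
have n0P n : (n0 <= n)%N -> x0 <= n%:R.
  by move=> nn; rewrite (le_trans (le_absz_ceil _))// ler_nat.
have nat_infty (f : R -> R) : f x @[x --> +oo] --> +oo ->
    (fun n => f n%:R) @ \oo --> +oo.
  by move=> foo; apply: (cvg_comp _ _ (@cvgr_idn R) foo).
have [|E mE Ediv] := @divergence_of_detection R d X mu Q mpQ
  (fun f x N => weighted_average a W T S f x N).
  move=> e N0 e0.
  apply: (@detection R d X mu Q theta k _ (fun n => W n%:R) n0 lX mpQ apQ) => //.
  - by move=> n /n0P /x0P[+ _ _ _ _]; apply.
  apply: (@window_dominates R (fun n => `|a n%:R|) (fun n => W n%:R)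
    (fun n => derive1 W n%:R) k n0).
  - move=> i j /andP[/n0P /x0P[_ mono _ _ _] ij]; apply: mono => //.
    by rewrite ler_nat.
  - exact: (nat_infty (fun x => `|a x|)).
  - by move=> n _; exact: absz_floor_dist.
  - by move=> n /n0P/x0P[_ _ _ /ltW].
  - move=> n nn; have [_ _ _ _ wni] := x0P _ (n0P _ nn).
    have := @derivable_increment_bounds R W n%:R n.+1%:R.
    rewrite -natr1 ltrDl ltr01 addrAC subrr add0r !mulr1; apply=> // z /andP[nz _].
    by have [] := x0P z (le_trans (n0P _ nn) nz).
  - exact: nat_infty.
  move=> C; have /near_pinftyP[M MP] :=
    hardy_ratio_ndecr C hH HA HW a_infty c0 Wc.
  exists `|Num.ceil M|%N => i j /andP[Mi ij]; apply: (MP M) => //.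
    by rewrite (le_trans (le_absz_ceil _))// ler_nat.
  by rewrite ler_nat.
exists \1_E => //; exact: indic_Lfun_oo.
Unshelve. all: by end_near.
Qed.
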